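(* Let $n\ge 2$. If $S$ is an admissible subset of $\{r,b,g,o,y,s\}$ with $|S|=3$ and $S\notin\{\{r,g,y\},\{s,b,r\}\}$, then \[F(J(T_n(S)),q)=\prod_{j=1}^{n-1}(1+q^j)^{n-j}=\prod_{1\le i\le j\le k\le n-1}\frac{[i+j]_q}{[i+j-1]_q}.\] In particular $|J(T_n(S))|=2^{\binom n2}$.
   Context: Let $T_n$ be the set of triples $(c_1,c_2,c_3)$ of nonnegative integers with $c_1+c_2+c_3\le n-2$. To the colors $r,g,y,b,o,s$ associate $v_r=(1,0,0)$, $v_g=(0,1,0)$, $v_y=(0,0,1)$, $v_b=(-1,1,0)$, $v_o=(-1,0,1)$, $v_s=(0,1,-1)$. For a set $S$ of colors, $T_n(S)$ is the poset on $T_n$ whose order is the reflexive–transitive closure of $p<p+v_x$ for $x\in S$ and $p,p+v_x\in T_n$. A set $S$ of colors is admissible if: $\{r,b\}\subseteq S\Rightarrow g\in S$; $\{o,s\}\subseteq S\Rightarrow b\in S$; $\{s,y\}\subseteq S\Rightarrow g\in S$; $\{r,o\}\subseteq S\Rightarrow y\in S$. $J(P)$ is the set of order ideals (down-closed subsets, including $\emptyset$) of $P$, $F(J(P),q)=\sum_{I\in J(P)}q^{|I|}$, and $[m]_q=1+q+\dots+q^{m-1}$.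
   Formalization: The second excluded set {s,b,r} is replaced by {s,b,g}: {s,b,r} is not admissible (it contains r,b but not g), while the admissible set {s,b,g} violates the claim, since T_3({s,b,g}) has 9 order ideals rather than 8. *)

(* Defs.v *)
(* MathComp *)
From HB Require Import structures.
From mathcomp Require Import all_boot all_order all_algebra.
From mathcomp Require Import zify.

Set Implicit Arguments.
Unset Strict Implicit.
Unset Printing Implicit Defensive.

Import Order.TTheory GRing.Theory Num.Theory.
Local Open Scope ring_scope.

Variant color := Red | Green | Yellow | Blue | Orange | Silver.

Definition color_to_ord (x : color) : 'I_6 :=
  match x with
  | Red => @Ordinal 6 0 isT | Green => @Ordinal 6 1 isT
  | Yellow => @Ordinal 6 2 isT | Blue => @Ordinal 6 3 isT
  | Orange => @Ordinal 6 4 isT | Silver => @Ordinal 6 5 isT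
  end.

Definition ord_to_color (i : 'I_6) : color :=
  match val i with
  | 0 => Red | 1 => Green | 2 => Yellow | 3 => Blue | 4 => Orange | _ => Silver
  end.

Lemma color_to_ordK : cancel color_to_ord ord_to_color.
Proof. by case. Qed.

HB.instance Definition _ := Finite.copy color (can_type color_to_ordK).

Definition color_vec (x : color) : int * int * int :=
  match x with
  | Red    => (1, 0, 0)
  | Green  => (0, 1, 0)
  | Yellow => (0, 0, 1)
  | Blue   => (-1, 1, 0)
  | Orange => (-1, 0, 1)
  | Silver => (0, 1, -1)
  end.

Definition admissible (S : {set color}) : bool :=
  [&& ([set Red; Blue] \subset S) ==> (Green \in S),
      ([set Orange; Silver] \subset S) ==> (Blue \in S),
      ([set Silver; Yellow] \subset S) ==> (Green \in S)
    & ([set Red; Orange] \subset S) ==> (Yellow \in S)].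

(* The source excludes {r, g, y} and {s, b, r} from the three-color sets, but
   {s, b, r} is not admissible, while the admissible set {s, b, g} (dual to
   {r, g, y}) fails the formula: for n = 3 it has 9 order ideals, not 8. The
   excluded set is therefore read as {s, b, g}. *)

(* Each coordinate of a point is at most n - 2, so ranging over 'I_n.-1 loses
   nothing when n >= 2. *)
Definition tetra_point (n : nat) : Type :=
  {c : 'I_n.-1 * 'I_n.-1 * 'I_n.-1 | (c.1.1 + c.1.2 + c.2 <= n - 2)%N}.

HB.instance Definition _ n := [Finite of tetra_point n by <:].

Definition coords n (p : tetra_point n) : int * int * int :=
  let c := val p in ((c.1.1 : nat)%:Z, (c.1.2 : nat)%:Z, (c.2 : nat)%:Z).

Definition tetra_step n (S : {set color}) : rel (tetra_point n) :=
  fun p p' => [exists x in S, coords p' == coords p + color_vec x].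

(* The index S only selects the order. *)
Definition tetra (n : nat) (S : {set color}) : Type := tetra_point n.

HB.instance Definition _ n S := Finite.on (tetra n S).

Fact tetra_display : Order.disp_t. Proof. exact: Order.Disp tt tt. Qed.

Section TetraOrder.
Variables (n : nat) (S : {set color}).

(* [connect] is the reflexive-transitive closure. *)
Definition tetra_le : rel (tetra n S) := connect (@tetra_step n S).

(* A linear functional that is positive on all six vectors. *)
Let weight (p : tetra_point n) : nat :=
  ((val p).1.1 + 3 * (val p).1.2 + 2 * (val p).2)%N.

Let weight_step p p' : tetra_step S p p' -> (weight p < weight p')%N.
Proof.
case/existsP=> x /andP[_ /eqP]; rewrite /coords /weight.
case: p => [[[a b] c] /= _]; case: p' => [[[a' b'] c'] /= _].
by case: x => -[] /=; lia.
Qed.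

Let weight_le p p' : tetra_le p p' -> (p == p') || (weight p < weight p')%N.
Proof.
case/connectP=> s; elim: s p => [|q s IHs] p /=; first by move=> _ ->; rewrite eqxx.
case/andP=> /weight_step lt_pq /IHs{}IHs /IHs /orP[/eqP <-|lt_q].
  by rewrite lt_pq orbT.
by rewrite (ltn_trans lt_pq lt_q) orbT.
Qed.

Lemma tetra_le_refl : reflexive tetra_le.
Proof. exact: connect0. Qed.

Lemma tetra_le_anti : antisymmetric tetra_le.
Proof.
move=> p q /andP[/weight_le/orP[/eqP//|lt_pq] /weight_le/orP[/eqP//|lt_qp]].
by have := ltn_trans lt_pq lt_qp; rewrite ltnn.
Qed.

Lemma tetra_le_trans : transitive tetra_le.
Proof. exact: connect_trans. Qed.

HB.instance Definition _ :=
  Order.Le_isPOrder.Build tetra_display (tetra n S)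
    tetra_le_refl tetra_le_anti tetra_le_trans.

End TetraOrder.

Definition order_ideals d (P : finPOrderType d) : {set {set P}} :=
  [set I : {set P} | [forall x in I, forall y, (y <= x)%O ==> (y \in I)]].

Definition ideal_genfun d (P : finPOrderType d) : {poly int} :=
  \sum_(I in order_ideals P) 'X^#|I|.

Definition qint (m : nat) : {poly int} := \sum_(i < m) 'X^i.

Notation "p %:F" := (FracField.tofrac p) : ring_scope.

(* Main.v *)
Require Import Defs.
From HB Require Import structures.
From mathcomp Require Import all_boot all_order all_algebra.
From mathcomp Require Import zify ring.

(* In the barycentric coordinates (n - 2 - c1 - c2 - c3, c1, c3, c2), each color
   moves one unit from an earlier coordinate to a later one, all six pairs occur,
   and S is admissible iff the corresponding relation on the four coordinates is
   transitive. Admissible three-color sets are thus naturally labelled posets on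
   four elements with three relations; apart from the two excluded claws there
   are only, up to a permutation of the coordinates, the chain x < y < z with w
   isolated, and the zigzag x < z > y < w.

   Chain: the poset is a disjoint union of triangles, one for each value of w.
   An ideal either contains the corner of a triangle, hence a whole side of
   length k, or avoids the corner, hence another whole side of length k. Both
   remainders are triangles of side k - 1, so the triangle of side k contributes
   the factor (1 + q) ... (1 + q^k).

   Zigzag: an ideal is determined by its heights h(x, w) on the lines with x and
   w fixed. The rows h(x, t - x) + 2 x, for x <= t <= n - 1, form a Gelfand-Tsetlin
   pattern with strict inequalities on one side and top row 0, 2, ..., 2 (n - 1).
   Summing over a row interlacing l_0, ..., l_k turns det (q^(m_i j)) into
   det (q^(l_i j)) up to explicit factors, and det (q^(2 i j)) is the same
   determinant as det (q^(i j)) with q^2 in place of q. *)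

Set Implicit Arguments.
Unset Strict Implicit.
Unset Printing Implicit Defensive.

Import Order.TTheory GRing.Theory Num.Theory.
Local Open Scope ring_scope.

(** * Alternants and interlacing *)

Section Alternant.
Variables (R : comNzRingType) (q : R).

(** The Vandermonde determinant with nodes [q ^+ l i]. *)
Definition alternant k (l : 'I_k -> nat) : R :=
  \det (\matrix_(i, j) q ^+ (l i * j)).

(** Subtracting from each row its predecessor, by the unitriangular [B], turns the first column of
    ones into (1, 0, ..., 0). *)
Lemma alternant_diff k (l : nat -> nat) :
  alternant (fun i : 'I_k.+1 => l i) =
  \det (\matrix_(i < k, j < k) (q ^+ (l i.+1 * j.+1) - q ^+ (l i * j.+1))).
Proof.
pose A : 'M[R]_k.+1 := \matrix_(i, j) q ^+ (l i * j).
pose B : 'M[R]_k.+1 := \matrix_(i, j) ((i == j)%:R - (i == j.+1 :> nat)%:R).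
have detB : \det B = 1.
  rewrite det_trig; last first.
    apply/is_trig_mxP=> i j ltij; rewrite mxE.
    by rewrite -val_eqE /= (ltn_eqF ltij) ltn_eqF ?subrr // ltnW.
  apply: big1 => i _; rewrite mxE eqxx eqn_leq ltnn andbF subr0 //.
have BA i j : (B *m A) i j = q ^+ (l i * j) - (0 < i)%:R * q ^+ (l i.-1 * j).
  rewrite mxE; under eq_bigr => h _ do rewrite !mxE mulrBl.
  rewrite sumrB (bigD1 i) //= eqxx mul1r big1 ?addr0; last first.
    by move=> h; rewrite eq_sym => /negPf->; rewrite mul0r.
  congr (_ - _); case: i => [[|i] lti] /=.
    by rewrite mul0r big1 // => h _; rewrite mul0r.
  have lti' : (i < k.+1)%N by apply: ltnW.
  rewrite (bigD1 (Ordinal lti')) //= eqxx mul1r big1 ?addr0 ?mul1r // => h.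
  by rewrite -val_eqE /= eqSS eq_sym => /negPf->; rewrite mul0r.
rewrite /alternant -/A -[\det A]mul1r -detB -det_mulmx (expand_det_col _ ord0).
rewrite (bigD1 ord0) //= big1 ?addr0 => [|i i0]; last first.
  rewrite BA !muln0 !expr0 mulr1.
  by rewrite lt0n (_ : (i != 0 :> nat) = true) ?subrr ?mul0r //; apply: i0.
rewrite BA muln0 mul0r subr0 expr0 mul1r /cofactor expr0 mul1r; congr (\det _).
by apply/matrixP=> i j; rewrite [LHS]mxE [LHS]mxE BA [RHS]mxE /= /bump /= !add1n mul1r.
Qed.

Lemma alternant_shift k (m : 'I_k -> nat) :
  \det (\matrix_(i < k, j < k) (q ^+ (m i * j.+1) * (q ^+ j.+1 - 1))) =
  q ^+ (\sum_i m i) * alternant m * \prod_(j < k) (q ^+ j.+1 - 1).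
Proof.
pose u : 'rV[R]_k := \row_i q ^+ m i; pose v : 'rV[R]_k := \row_j (q ^+ j.+1 - 1).
rewrite [LHS](_ : _ = \det (diag_mx u *m (\matrix_(i, j) q ^+ (m i * j)) *m diag_mx v)).
  rewrite !det_mulmx !det_diag -/(alternant m) expr_sum.
  by congr (_ * _ * _); apply: eq_bigr => i _; rewrite mxE.
congr (\det _); apply/matrixP=> i j.
by rewrite mul_mx_diag mxE mul_diag_mx !mxE mulnS exprD.
Qed.

(** Multilinearity of the determinant in its rows. *)
Lemma det_sum_rows k (J : finType) (P : 'I_k -> pred J) (F : 'I_k -> 'I_k -> J -> R) :
  \det (\matrix_(i < k, j < k) \sum_(h | P i h) F i j h) =
  \sum_(m in family P) \det (\matrix_(i < k, j < k) F i j (m i)).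
Proof.
rewrite /determinant exchange_big /=; apply: eq_bigr => s _.
rewrite -mulr_sumr; congr (_ * _); under eq_bigr => i _ do rewrite mxE.
rewrite bigA_distr_big_dep; apply: eq_bigr => f _.
by apply: eq_bigr => i _; rewrite mxE.
Qed.

(** Each entry of [alternant_diff] telescopes over the integers [a] with [l i <= a < l i.+1], and
    multilinearity moves these sums out of the determinant. The bound [K] confines the choices to a
    finite type. *)
Lemma alternant_interlace k K (l : nat -> nat) :
    (forall i, i < k -> l i <= l i.+1 <= K)%N ->
  alternant (fun i : 'I_k.+1 => l i) =
  (\sum_(m in family (fun i : 'I_k => [pred a : 'I_K | l i <= a < l i.+1]%N))
     q ^+ (\sum_i m i) * alternant (fun i => m i)) *
  \prod_(j < k) (q ^+ j.+1 - 1).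
Proof.
move=> hl; rewrite alternant_diff mulr_suml.
under [RHS]eq_bigr => m _ do rewrite -alternant_shift.
rewrite -(det_sum_rows (fun i : 'I_k => [pred a : 'I_K | l i <= a < l i.+1]%N)
  (fun i j a => q ^+ (a * j.+1) * (q ^+ j.+1 - 1))).
congr (\det _); apply/matrixP=> i j; rewrite !mxE.
have /andP[le_l leK] := hl _ (ltn_ord i).
rewrite -(telescope_sumr (fun a => q ^+ (a * j.+1)) le_l).
rewrite (big_nat_widen _ _ _ _ _ leK) (big_nat_widenl _ 0%N) // big_mkord.
apply: eq_big => [a|a _] /=; first by rewrite andbC.
by rewrite mulSn addnC exprD mulrBr mulr1.
Qed.

(** Only [a = i] lies between [i] and [i.+1], so each telescoping sum has one term. *)
Lemma alternant_id k :
  alternant (fun i : 'I_k.+1 => i) =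
  q ^+ (\sum_(i < k) i) * alternant (fun i : 'I_k => i) *
  \prod_(j < k) (q ^+ j.+1 - 1).
Proof.
rewrite -alternant_shift (alternant_diff _ id); congr (\det _).
by apply/matrixP=> i j; rewrite !mxE mulSn addnC exprD mulrBr mulr1.
Qed.

End Alternant.

Lemma alternant_sqr (R : comNzRingType) (q : R) k :
  alternant q (fun i : 'I_k => 2 * i)%N = alternant (q ^+ 2) (fun i : 'I_k => i).
Proof.
by congr (\det _); apply/matrixP=> i j; rewrite !mxE -exprM mulnA.
Qed.

(** Induction by [alternant_id] at [q ^+ 2], each difference of squares being factored. The first
    product has the form in which repeated interlacing produces it, ready to be cancelled. *)
Lemma alternant_double (R : comNzRingType) (q : R) k :
  alternant q (fun i : 'I_k => 2 * i)%N =
  \prod_(t < k) (q ^+ (\sum_(i < t) 2 * i) * \prod_(j < t) (q ^+ j.+1 - 1)) *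
  \prod_(t < k) \prod_(j < t) (1 + q ^+ j.+1).
Proof.
rewrite alternant_sqr; elim: k => [|k IHk].
  by rewrite !big_ord0 /alternant det_mx00 mulr1.
have sqr_fact : \prod_(j < k) ((q ^+ 2) ^+ j.+1 - 1) =
    \prod_(j < k) (q ^+ j.+1 - 1) * \prod_(j < k) (1 + q ^+ j.+1).
  rewrite -big_split; apply: eq_bigr => j _ /=.
  by rewrite -exprM mulnC exprM; ring.
rewrite alternant_id IHk sqr_fact !big_ord_recr /= -exprM -big_distrr /=.
by ring.
Qed.

(** * Order ideals *)

Section DownClosed.
Variables (T : finType) (e : rel T).
Implicit Types A B C I : {set T}.

(** Closure under single steps between points of [A]; a path that leaves [A] imposes no
    condition. *)
Definition down_closed A I :=
  (I \subset A) && [forall p in A, forall p' in I, e p p' ==> (p \in I)].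

Definition genfun A : {poly int} := \sum_(I | down_closed A I) 'X^#|I|.

Lemma down_closedP A I :
  reflect ((forall p, p \in I -> p \in A) /\
           (forall p p', p \in A -> p' \in I -> e p p' -> p \in I))
          (down_closed A I).
Proof.
apply: (iffP andP) => -[/subsetP sIA clI]; split=> //.
  by move=> p p' Ap Ip'; move/forall_inP: clI => /(_ p Ap)/forall_inP/(_ p' Ip')/implyP.
apply/forall_inP=> p Ap; apply/forall_inP=> p' Ip'.
by apply/implyP; apply: clI Ap Ip'.
Qed.

(** The ideals through [p0] contain the down-closed [C1], and removing it leaves an arbitrary ideal
    of [A :\: C1]. The others avoid the up-closed [C2], so they are the ideals of [A :\: C2]. *)
Lemma genfun_split A C1 C2 p0 :
    p0 \in C1 -> p0 \in C2 -> C1 \subset A -> C2 \subset A ->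
    (forall p p', p \in A -> p' \in C1 -> e p p' -> p \in C1) ->
    (forall p p', p \in C2 -> p' \in A -> e p p' -> p' \in C2) ->
    (forall I, down_closed A I -> p0 \in I -> C1 \subset I) ->
    (forall I, down_closed A I -> p0 \notin I -> [disjoint I & C2]) ->
  genfun A = 'X^#|C1| * genfun (A :\: C1) + genfun (A :\: C2).
Proof.
move=> p0C1 p0C2 sC1A sC2A dC1 uC2 inC1 outC2.
rewrite /genfun (bigID (fun I => p0 \in I)) /=; congr (_ + _); last first.
  apply: eq_bigl => I; apply/andP/idP.
    case=> clI p0I; move/down_closedP: (clI) => [sIA dI]; apply/down_closedP.
    split=> [p Ip|p p' /setDP[Ap _] Ip' epp']; last exact: dI Ip' epp'.
    by rewrite inE sIA // andbT (disjointFr (outC2 _ clI p0I)).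
  case/down_closedP=> sI dI; split; last first.
    by apply/negP=> /sI; rewrite inE p0C2.
  apply/down_closedP; split=> [p /sI/setDP[]//|p p' Ap Ip' epp'].
  apply: dI (Ip') (epp'); rewrite inE Ap andbT; apply/negP=> pC2.
  by have /setDP[Ap' /negP[]] := sI _ Ip'; apply: uC2 epp'.
rewrite big_distrr /=.
rewrite (reindex_onto (fun I => C1 :|: I) (fun I => I :\: C1)) /=; last first.
  move=> I /andP[clI p0I]; apply/setP=> p; rewrite !inE.
  by case: (boolP (p \in C1)) => //= pC1; rewrite (subsetP (inC1 _ clI p0I)).
apply: eq_big => [I|I /andP[/andP[_ _] /eqP defI]]; last first.
  have dis: C1 :&: I = set0.
    by rewrite -defI; apply/setP=> p; rewrite !inE; case: (p \in C1).
  by rewrite cardsU dis cards0 subn0 exprD.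
apply/idP/idP.
  case/andP=> /andP[/down_closedP[sU dU] _] /eqP defI.
  have notC1 p : p \in I -> p \notin C1 by rewrite -{1}defI !inE => /andP[].
  apply/down_closedP; split=> [p Ip|p p' /setDP[Ap pC1] Ip' epp'].
    by rewrite inE notC1 //= sU // inE Ip orbT.
  have := dU p p' Ap; rewrite !inE Ip' orbT (negPf pC1) /= => -> //.
case/down_closedP=> sI dI; have notC1 p : p \in I -> p \notin C1 by case/sI/setDP.
apply/andP; split; last first.
  apply/eqP/setP=> p; rewrite !inE; case: (boolP (p \in C1)) => //= pC1.
  by apply/esym/negP=> /notC1/negP.
apply/andP; split; last by rewrite inE p0C1.
apply/down_closedP; split=> [p|p p' Ap].
  by rewrite inE => /orP[/(subsetP sC1A)|/sI/setDP[]].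
rewrite !inE; case: (boolP (p \in C1)) => //= pC1.
case/orP=> [C1p' epp'|Ip' epp']; first by have := dC1 _ _ Ap C1p' epp'; rewrite (negPf pC1).
by apply: dI Ip' epp'; rewrite inE pC1.
Qed.

End DownClosed.

(** * Barycentric coordinates on a tetrahedron *)

Definition transfer T (f g h k : T -> nat) : rel T :=
  fun p p' => [&& f p == (f p').+1, g p' == (g p).+1, h p == h p' & k p == k p'].

Definition barycentric T N (x y z w : T -> nat) :=
  [/\ forall p, (x p + y p + z p + w p = N)%N,
      forall p p', x p = x p' -> y p = y p' -> z p = z p' -> w p = w p' -> p = p'
    & forall i j k l, (i + j + k + l = N)%N ->
        exists p, [/\ x p = i, y p = j, z p = k & w p = l]].

(** Together with the rotation below, this generates all permutations of the coordinates. *)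
Lemma barycentric_swap T N (x y z w : T -> nat) :
  barycentric N x y z w -> barycentric N y x z w.
Proof.
case=> hs hi hx; split=> [p|p p' *|i j k l h]; [by rewrite -(hs p); lia|by apply: hi|].
by have [|p []] := hx j i k l; [lia | exists p].
Qed.

Lemma barycentric_rot T N (x y z w : T -> nat) :
  barycentric N x y z w -> barycentric N y z w x.
Proof.
case=> hs hi hx; split=> [p|p p' *|i j k l h]; [by rewrite -(hs p); lia|by apply: hi|].
by have [|p []] := hx l i j k; [lia | exists p].
Qed.

Section Line.
Variables (T : finType) (N : nat) (x y z w : T -> nat).
Hypothesis coords : barycentric N x y z w.
Let coord_sum := let: And3 h _ _ := coords in h.
Let coord_inj := let: And3 _ h _ := coords in h.
Let coord_surj := let: And3 _ _ h := coords in h.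

(** On such a line [z] determines the point, and the hypothesis leaves room for every value of [z]
    below [m]. *)
Lemma card_line i l m : (m + i + l <= N.+1)%N ->
  #|[set p | [&& x p == i, w p == l & (z p < m)%N]]| = m.
Proof.
move=> hm; pose D := [set p | [&& x p == i, w p == l & (z p < m)%N]].
have injD : {in D &, injective z}.
  move=> p p'; rewrite !inE => /and3P[/eqP xp /eqP wp _] /and3P[/eqP xp' /eqP wp' _].
  have := coord_sum p; have := coord_sum p' => sp' sp zz.
  by apply: coord_inj; lia.
have sz : [seq z p | p in D] =i iota 0 m.
  move=> a; rewrite mem_iota /= add0n; apply/imageP/idP.
    by case=> p; rewrite inE => /and3P[_ _ lt] ->.
  move=> lt; have [|p [xp yp zp wp]] := @coord_surj i (N - i - l - a)%N a l; first lia.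
  by exists p => //; rewrite inE xp wp zp !eqxx.
have := perm_size (uniq_perm _ (iota_uniq 0 m) sz).
rewrite size_iota size_map -cardE; apply.
by rewrite map_inj_in_uniq ?enum_uniq // => p p'; rewrite !mem_enum; apply: injD.
Qed.

End Line.

(** * Ideals for the chain x < y < z *)

Section Quadruples.
Variables (T : finType) (e : rel T) (N : nat) (x y z w : T -> nat).
Hypothesis coords : barycentric N x y z w.
Let coord_sum := let: And3 h _ _ := coords in h.
Let coord_inj := let: And3 _ h _ := coords in h.
Let coord_surj := let: And3 _ _ h := coords in h.

Section Chain.
Hypothesis chainE : forall p p',
  e p p' = [|| transfer x y z w p p', transfer x z y w p p' | transfer y z x w p p'].

(** A triangle in the level [w = d]; its sides [z = lo] and [y + z = hi - 1] are peeled off by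
    raising [lo] or lowering [hi]. *)
Let tri d lo hi := [set p | [&& w p == d, (lo <= z p)%N & (y p + z p < hi)%N]].

(** No step changes [w], so [A] does not interact with the triangle. Both ways of peeling side
    [k.+1] leave a triangle of side [k], whence the factor [1 + 'X^k.+1]. *)
Lemma genfun_triangle (A : {set T}) d k lo hi :
    (hi = lo + k)%N -> (hi + d <= N.+1)%N -> {in A, forall p, w p != d} ->
  genfun e (A :|: tri d lo hi) = genfun e A * \prod_(j < k) (1 + 'X ^+ j.+1).
Proof.
move=> + + hA; elim: k lo hi => [|k IHk] lo hi hhi hd.
  rewrite big_ord0 mulr1; congr genfun; apply/setP=> p.
  by rewrite !inE; case: (p \in A) => //=; lia.
(* The corner [p0] common to the two sides is the top of [C1] and the bottom of [C2]. *)
pose C1 := [set p | [&& w p == d, z p == lo & (y p + z p < hi)%N]].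
pose C2 := [set p | [&& w p == d, y p + z p == hi.-1 & (lo <= z p)%N]].
have [|p0 [xp0 yp0 zp0 wp0]] := @coord_surj (N - d - lo - k)%N k lo d; first lia.
have D1 : (A :|: tri d lo hi) :\: C1 = A :|: tri d lo.+1 hi.
  apply/setP=> p; rewrite !inE; case: (boolP (p \in A)) => [/hA|_] /=; last lia.
  by move/negPf->.
have D2 : (A :|: tri d lo hi) :\: C2 = A :|: tri d lo hi.-1.
  apply/setP=> p; rewrite !inE; case: (boolP (p \in A)) => [/hA|_] /=; last lia.
  by move/negPf->.
rewrite (@genfun_split _ e _ C1 C2 p0).
- rewrite D1 D2 (IHk lo.+1 hi) ?(IHk lo hi.-1); try lia.
  rewrite (_ : #|C1| = k.+1) ?big_ord_recr /=; first by ring.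
  have wxyz := barycentric_rot (barycentric_rot (barycentric_rot coords)).
  rewrite -(card_line wxyz (i := d) (l := lo) (m := k.+1)); last lia.
  by apply: eq_card => p; rewrite !inE; lia.
- by rewrite !inE; lia.
- by rewrite !inE; lia.
- by apply/subsetP=> p; rewrite !inE; lia.
- by apply/subsetP=> p; rewrite !inE; lia.
- move=> p p'; rewrite !inE chainE /transfer.
  by case/orP => [/hA|]; lia.
- move=> p p'; rewrite !inE chainE /transfer.
  by move=> + /orP[/hA|]; lia.
- move=> I /down_closedP[_ dI] p0I; apply/subsetP=> p; rewrite inE.
  (* Climb along [C1] to [p0], moving units from [x] to [y]. *)
  have [m] := ubnP (hi - y p)%N; elim: m p => // m IHm p lem hp.
  have [eqk|neqk] := eqVneq (y p) k.
    by rewrite (_ : p = p0) //; have := coord_sum p; have := coord_sum p0; move=> *; apply: coord_inj; lia.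
  have sp := coord_sum p.
  have [|p' [xp' yp' zp' wp']] := @coord_surj (x p).-1 (y p).+1 (z p) (w p); first lia.
  apply: (dI p p'); rewrite ?inE ?chainE /transfer; try lia.
  by apply: IHm; lia.
- move=> I /down_closedP[_ dI] p0I.
  rewrite disjoint_sym disjoint_subset; apply/subsetP=> p; rewrite !inE => hp.
  (* Descend along [C2] to [p0], moving units from [z] back to [y]. *)
  apply: contra p0I; have [m] := ubnP (z p)%N; elim: m p hp => // m IHm p hp lem Ip.
  have sp := coord_sum p.
  have [eqk|neqk] := eqVneq (z p) lo.
    by rewrite (_ : p0 = p) //; have := coord_sum p0; move=> *; apply: coord_inj; lia.
  have [|p' [xp' yp' zp' wp']] := @coord_surj (x p) (y p).+1 (z p).-1 (w p); first lia.
  apply: (IHm p'); try lia.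
  by apply: (dI p' p); rewrite ?inE ?chainE /transfer //; lia.
Qed.

(** Level [w = i] is a triangle of side [t = N.+1 - i]; the factor for [t = 0] is empty. *)
Lemma genfun_chain :
  genfun e setT = \prod_(t < N.+2) \prod_(j < t) (1 + 'X ^+ j.+1).
Proof.
have levels d : (d <= N.+1)%N ->
    genfun e [set p | (w p < d)%N] =
    \prod_(i < d) \prod_(j < N.+1 - i) (1 + 'X ^+ j.+1).
  elim: d => [|d IHd] hd.
    rewrite big_ord0 /genfun (big_pred1 set0) ?cards0 // => I.
    apply/down_closedP/eqP=> [[sI _]|->].
      by apply/setP=> p; rewrite inE; apply/negP=> /sI; rewrite inE.
    by split=> [p|p p']; rewrite inE.
  rewrite big_ord_recr /= -IHd 1?ltnW //.
  rewrite -(@genfun_triangle _ d _ 0 (N.+1 - d)%N); try lia.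
    congr genfun; apply/setP=> p; rewrite !inE; have := coord_sum p; lia.
  by move=> p; rewrite inE; lia.
rewrite big_ord_recl big_ord0 mul1r /=.
rewrite (reindex_inj rev_ord_inj) /= (_ : setT = [set p | (w p < N.+1)%N]).
  rewrite levels //; apply: eq_bigr => i _.
  by rewrite /bump /= (_ : (1 + (N.+1 - i.+1) = N.+1 - i)%N) //; have := ltn_ord i; lia.
by apply/setP=> p; rewrite !inE; have := coord_sum p; lia.
Qed.

End Chain.

End Quadruples.

(** * Ideals for the zigzag x < z > y < w *)

Section Zigzag.
Variables (T : finType) (e : rel T) (N : nat) (x y z w : T -> nat).
Hypothesis coords : barycentric N x y z w.
Let coord_sum := let: And3 h _ _ := coords in h.
Let coord_inj := let: And3 _ h _ := coords in h.
Let coord_surj := let: And3 _ _ h := coords in h.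
Hypothesis zigzagE : forall p p',
  e p p' = [|| transfer x z y w p p', transfer y z x w p p' | transfer y w x z p p'].

Let e_xz p p' :
  x p = (x p').+1 -> z p' = (z p).+1 -> y p = y p' -> w p = w p' -> e p p'.
Proof. by rewrite zigzagE /transfer => -> -> -> ->; rewrite !eqxx. Qed.

Let e_yz p p' :
  y p = (y p').+1 -> z p' = (z p).+1 -> x p = x p' -> w p = w p' -> e p p'.
Proof. by rewrite zigzagE /transfer => -> -> -> ->; rewrite !eqxx orbT. Qed.

Let e_yw p p' :
  y p = (y p').+1 -> w p' = (w p).+1 -> x p = x p' -> z p = z p' -> e p p'.
Proof. by rewrite zigzagE /transfer => -> -> -> ->; rewrite !eqxx !orbT. Qed.

(** Row [t] is [x + w = t]. Ideals are built by adding rows in decreasing order of [t], starting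
    from the empty [upper N.+1]. *)
Let upper t := [set p | (t <= x p + w p)%N].
Let height (B : {set T}) i l := #|[set p in B | (x p == i) && (w p == l)]|.
(* The slope 2 turns the two ideal conditions between consecutive rows,
   h(x, w + 1) <= h(x, w) <= h(x + 1, w) + 1, into interlacing. *)
Let slanted (B : {set T}) t i := (height B i (t - i) + 2 * i)%N.

Let mem_line t B p p' : down_closed e (upper t) B -> p' \in B ->
  x p = x p' -> w p = w p' -> (z p <= z p')%N -> p \in B.
Proof.
case/down_closedP=> sB dB; have [m] := ubnP (z p' - z p)%N.
elim: m p => // m IHm p lem Bp' xp wp; rewrite leq_eqVlt => /orP[/eqP eqz|ltz].
  rewrite (_ : p = p') //; have := coord_sum p; have := coord_sum p'.
  by move=> *; apply: coord_inj; lia.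
have sp := coord_sum p; have sp' := coord_sum p'.
have [|q [xq yq zq wq]] := @coord_surj (x p) (y p).-1 (z p).+1 (w p); first lia.
have := sB _ Bp'; rewrite inE => hp'.
by apply: (dB p q); [rewrite inE; lia | apply: IHm; lia | apply: e_yz; lia].
Qed.

(** By [mem_line], an ideal meets each line in an initial segment for [z]. *)
Let mem_height t B p : down_closed e (upper t) B ->
  (p \in B) = (z p < height B (x p) (w p))%N.
Proof.
move=> clB; have sp := coord_sum p; have line := card_line coords.
apply/idP/idP=> [Bp|].
  rewrite -[leqLHS](line (x p) (w p)); last lia.
  apply: subset_leq_card; apply/subsetP=> p'; rewrite !inE => /and3P[/eqP xp /eqP wp zp].
  by rewrite xp wp !eqxx /= andbT; apply: (mem_line clB Bp).
apply: contraTT => Bp; rewrite -leqNgt -[leqRHS](line (x p) (w p)); last lia.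
apply: subset_leq_card; apply/subsetP=> p'; rewrite !inE => /and3P[Bp' xp wp].
rewrite xp wp ltnNge /=; apply: contra Bp => le_z.
by apply: (mem_line clB Bp') => //; apply/esym/eqP.
Qed.

Let height_le B i l : (i + l <= N.+1)%N -> (height B i l <= N.+1 - i - l)%N.
Proof.
move=> hil; rewrite -[leqRHS](card_line coords (i := i) (l := l)); last lia.
apply: subset_leq_card; apply/subsetP=> p; rewrite !inE => /and3P[_ /eqP xp /eqP wp].
by have := coord_sum p; lia.
Qed.

(** Provides the hypothesis of [alternant_interlace]. Neighbouring lines of row [t.+1] are compared
    through a point [q] of row [t.+2], since [upper t.+1] does not contain row [t]. *)
Let slanted_mono t B i : (i <= t <= N)%N -> down_closed e (upper t.+1) B ->
  (slanted B t.+1 i <= slanted B t.+1 i.+1 <= 3 * N + 5)%N.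
Proof.
move=> hi clB; have := clB => /down_closedP[sB dB].
rewrite /slanted subSS; have h1 := @height_le B i (t.+1 - i)%N.
have h2 := @height_le B i.+1 (t - i)%N.
apply/andP; split; last by lia.
rewrite leqNgt; apply/negP=> {h2}.
case Ea: (height B i _) h1 => [|[|a]] h1 lt_h; try lia.
have [|p' [xp' yp' zp' wp']] := @coord_surj i (N - t.+1 - a.+1)%N a.+1 (t.+1 - i)%N.
  by lia.
have Bp' : p' \in B by rewrite (mem_height _ clB) xp' wp' zp' Ea.
have {h1 Ea} sp' := coord_sum p'.
have [|q [xq yq zq wq]] := @coord_surj i.+1 (y p') a (t.+1 - i)%N; first lia.
have Bq : q \in B by apply: dB Bp' _; [rewrite inE; lia | apply: e_xz; lia].
have [|r [xr yr zr wr]] := @coord_surj i.+1 (y p').+1 a (t - i)%N; first lia.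
have Br : r \in B by apply: dB Bq _; [rewrite inE; lia | apply: e_yw; lia].
by move: Br; rewrite (mem_height _ clB) xr zr wr; lia.
Qed.

(** A crude bound on slanted heights, so that rows are functions into a finite type. *)
Let K := (3 * N + 5)%N.
Let bound t (m : {ffun 'I_t.+1 -> 'I_K}) i : nat := m (inord i).
Let bound_val t (m : {ffun 'I_t.+1 -> 'I_K}) (i : 'I_t.+1) : bound m i = m i.
Proof. by rewrite /bound inord_val. Qed.

Let row t (m : {ffun 'I_t.+1 -> 'I_K}) :=
  [set p | (x p + w p == t) && (z p + 2 * x p < bound m (x p))%N].
Let interlacing B t := family (fun i : 'I_t.+1 =>
  [pred a : 'I_K | slanted B t.+1 i <= a < slanted B t.+1 i.+1]%N).

Let disjoint_row t B m : down_closed e (upper t.+1) B -> [disjoint B & @row t m].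
Proof.
case/down_closedP=> sB _; rewrite disjoint_subset; apply/subsetP=> p /sB.
by rewrite !inE; lia.
Qed.

Let mem_interlacing B t (m : {ffun 'I_t.+1 -> 'I_K}) : m \in interlacing B t ->
  forall i, (i <= t)%N ->
  (height B i (t.+1 - i) + 2 * i <= bound m i < height B i.+1 (t - i) + 2 * i.+1)%N.
Proof.
by move=> /familyP hm i hi; have := hm (inord i); rewrite /bound inE inordK // /slanted subSS.
Qed.

Let height_row t B m i : (t <= N)%N -> down_closed e (upper t.+1) B ->
  m \in interlacing B t -> (i <= t)%N ->
  height (B :|: @row t m) i (t - i)%N = (bound m i - 2 * i)%N.
Proof.
move=> ht clB hm hi; have := mem_interlacing hm hi.
have := @height_le B i.+1 (t - i)%N => h1 h2.
rewrite -[RHS](card_line coords (i := i) (l := (t - i)%N)); last lia.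
have := clB => /down_closedP[sB _].
apply: eq_card => p; rewrite !inE.
have [Bp|_] := boolP (p \in B); first by have := sB _ Bp; rewrite inE; lia.
case: (x p =P i) => [->|]; last by rewrite !andbF.
by lia.
Qed.

(** The line [x = i] receives [m i - 2 * i] points; interlacing ensures that this subtraction does
    not truncate. *)
Let card_row t B m : (t <= N)%N -> down_closed e (upper t.+1) B ->
  m \in interlacing B t ->
  (#|@row t m| + \sum_(i < t.+1) 2 * i = \sum_i m i)%N.
Proof.
move=> ht clB hm.
have -> : #|@row t m| = (\sum_(i < t.+1) (m i - 2 * i))%N.
  rewrite -sum1_card (partition_big (fun p => inord (x p) : 'I_t.+1) xpredT) //=.
  apply: eq_bigr => i _; have hi : (i <= t)%N by rewrite -ltnS.
  rewrite sum1_card -bound_val -(height_row ht clB hm hi).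
  apply: eq_card => p; rewrite !inE /=; rewrite unfold_in /= !inE.
  have := clB => /down_closedP[sB _].
  have [Bp|_] := boolP (p \in B).
    have := sB _ Bp; rewrite inE.
    case: (x p + w p =P t)%N => //=; lia.
  case: (x p + w p =P t)%N => /= [hp|]; last lia.
  have -> : (inord (x p) == i) = (x p == i).
    by rewrite -val_eqE /= inordK //; lia.
  lia.
rewrite -big_split; apply: eq_bigr => i _ /=; rewrite subnK //.
have := mem_interlacing hm (ltn_ord i : i <= t)%N.
by rewrite bound_val; lia.
Qed.

(** The lower interlacing inequality handles the steps from [y] to [w], which lead from row [t] to
    row [t.+1]; the upper one handles those from [x] to [z], which lead from row [t.+1] to row
    [t]. *)
Let down_closed_row t B m : (t <= N)%N -> down_closed e (upper t.+1) B ->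
  m \in interlacing B t -> down_closed e (upper t) (B :|: @row t m).
Proof.
move=> ht clB hm; have := clB => /down_closedP[sB dB].
apply/down_closedP; split=> [p|p p' hp].
  by rewrite !inE => /orP[/sB|]; rewrite ?inE; lia.
have := hp; rewrite !inE zigzagE /transfer => hp1 /orP[Bp'|].
  have := sB _ Bp'; rewrite inE => hp'.
  have [hpt|hpt] := eqVneq (x p + w p)%N t; last first.
    by move=> epp'; rewrite (dB p p') // ?inE ?zigzagE /transfer //; lia.
  move=> epp'; have xpp' : x p' = x p by lia.
  have := Bp'; rewrite (mem_height _ clB) xpp' => hz.
  have := mem_interlacing hm (_ : x p <= t)%N => hmx.
  suff : (z p + 2 * x p < bound m (x p))%N by move->; rewrite orbT.
  have wE : w p' = (t.+1 - x p)%N by lia.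
  by move: hz; rewrite wE; lia.
move=> /andP[/eqP hp' hz] epp'.
have [epy|] := boolP (transfer y z x w p p').
  have xpp' : x p = x p' by move: epy; rewrite /transfer; lia.
  by move: epy hz; rewrite /transfer xpp' => epy hz; apply/orP; right; apply/andP; lia.
rewrite /transfer => nepp'.
have : p \in B.
  have := mem_interlacing hm (_ : x p' <= t)%N => hmx.
  have xp : (x p').+1 = x p by lia.
  have wE : (t - x p')%N = w p by lia.
  by rewrite xp wE in hmx; rewrite (mem_height _ clB); lia.
by move->.
Qed.

(** Converse of [down_closed_row]: the same two kinds of steps force the two inequalities. *)
Let interlacing_of t B B' : (t <= N)%N ->
  down_closed e (upper t.+1) B -> down_closed e (upper t) B' ->
  B' :&: upper t.+1 = B -> forall i, (i <= t)%N ->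
  (slanted B t.+1 i <= slanted B' t i < slanted B t.+1 i.+1)%N.
Proof.
move=> ht clB clB' defB i hi; rewrite /slanted subSS.
have := clB' => /down_closedP[sB' dB'].
have inB p : (p \in B) = (p \in B') && (t < x p + w p)%N by rewrite -defB !inE.
have h1 := @height_le B i (t.+1 - i)%N; have h2 := @height_le B' i (t - i)%N.
apply/andP; split.
  rewrite leq_add2r leqNgt; apply/negP=> {h2}.
  case Ea: (height B i _) h1 => [|a] h1 lt_h //.
  have [|p' [xp' yp' zp' wp']] := @coord_surj i (N - t.+1 - a)%N a (t.+1 - i)%N.
    by lia.
  have Bp' : p' \in B by rewrite (mem_height _ clB) xp' wp' zp' Ea.
  have {h1 Ea} sp' := coord_sum p'.
  have [|p [xp yp zp wp]] := @coord_surj i (y p').+1 a (t - i)%N; first lia.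
  have: p \in B'.
    have := Bp'; rewrite inB => /andP[B'p' _].
    by apply: dB' B'p' _; [rewrite inE; lia | apply: e_yw; lia].
  by rewrite (mem_height _ clB') xp wp zp; lia.
rewrite ltnNge; apply/negP=> {h1}.
case Ea: (height B' i _) h2 => [|[|a]] h2 le_h; try lia.
have [|p' [xp' yp' zp' wp']] := @coord_surj i (N - t - a.+1)%N a.+1 (t - i)%N.
  by lia.
have Bp' : p' \in B' by rewrite (mem_height _ clB') xp' wp' zp' Ea.
have {h2 Ea} sp' := coord_sum p'.
have [|p [xp yp zp wp]] := @coord_surj i.+1 (y p') a (t - i)%N; first lia.
have: p \in B.
  rewrite inB xp wp (_ : _ < _ = true)%N ?andbT; last lia.
  by apply: dB' Bp' _; [rewrite inE; lia | apply: e_xz; lia].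
by rewrite (mem_height _ clB) xp wp zp; lia.
Qed.

Let sum_extensions t B (F : {set T} -> {poly int}) : (t <= N)%N ->
  down_closed e (upper t.+1) B ->
  \sum_(B' | down_closed e (upper t) B' && (B' :&: upper t.+1 == B)) F B' =
  \sum_(m in interlacing B t) F (B :|: row m).
Proof.
move=> ht clB; have lt0K : (0 < K)%N by rewrite /K addnS.
(* The default of [insubd] is never reached on the extensions of [B], whose slanted heights stay
   below [K] by interlacing. *)
pose heights B' := [ffun i : 'I_t.+1 => insubd (Ordinal lt0K) (slanted B' t i)].
have heightsE B' i : down_closed e (upper t) B' -> B' :&: upper t.+1 = B ->
    heights B' i = slanted B' t i :> nat.
  move=> clB' defB; rewrite ffunE val_insubd ifT //.
  have hi : (i <= t)%N by rewrite -ltnS.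
  have := interlacing_of ht clB clB' defB hi.
  by have := @slanted_mono t B i _ clB; rewrite hi ht => /(_ isT); rewrite /K; lia.
rewrite (reindex_onto (fun m => B :|: row m) heights) /=; last first.
  move=> B' /andP[clB' /eqP defB]; apply/setP=> p; rewrite !inE.
  have -> : (p \in B) = (p \in B') && (t < x p + w p)%N by rewrite -defB !inE.
  have := clB' => /down_closedP[sB' _].
  have [hp|hp] /= := eqVneq (x p + w p)%N t; last first.
    by rewrite orbF; case: (boolP (p \in B')) => //= /sB'; rewrite inE; lia.
  rewrite hp ltnn andbF /= /bound heightsE // /slanted inordK; last lia.
  by rewrite (mem_height _ clB') (_ : t - x p = w p)%N; lia.
apply: eq_bigl => m; apply/idP/idP.
  case/andP=> /andP[clB' /eqP defB] /eqP defm; apply/familyP=> i.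
  rewrite inE -{1 2}defm heightsE //.
  by apply: interlacing_of => //; rewrite -ltnS.
move=> hm; have clB' := down_closed_row ht clB hm.
have defB : (B :|: row m) :&: upper t.+1 = B.
  have := clB => /down_closedP[sB _]; apply/setP=> p; rewrite !inE.
  by have [/sB|_] := boolP (p \in B); rewrite ?inE; lia.
rewrite clB' defB eqxx /=; apply/eqP/ffunP=> i; apply/val_inj; rewrite /= heightsE //.
have hi : (i <= t)%N by rewrite -ltnS.
rewrite /slanted (height_row ht clB hm hi) subnK ?bound_val //.
by have := mem_interlacing hm hi; rewrite bound_val; lia.
Qed.

(* Ideals extending a prescribed part B of the rows t, t + 1, ..., N + 1,
   weighted by the elements they add to B. *)
Let extensions t (B : {set T}) : {poly int} :=
  \sum_(I | down_closed e (upper 0) I && (I :&: upper t == B)) 'X^#|I :\: B|.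

(** The ideals are sorted by their trace [B'] on [upper t]. *)
Let extensionsS t B : down_closed e (upper t.+1) B ->
  extensions t.+1 B =
  \sum_(B' | down_closed e (upper t) B' && (B' :&: upper t.+1 == B))
     'X^#|B' :\: B| * extensions t B'.
Proof.
move=> clB; rewrite /extensions.
have upperS : upper t :&: upper t.+1 = upper t.+1.
  by apply/setP=> p; rewrite !inE; lia.
rewrite (partition_big (fun I => I :&: upper t)
   (fun B' => down_closed e (upper t) B' && (B' :&: upper t.+1 == B))) /=.
  apply: eq_bigr => B' /andP[_ /eqP defB]; rewrite big_distrr /=.
  apply: eq_big => [I|I /andP[/andP[_ /eqP defB1] /eqP defB2]].
    rewrite -andbA; congr (_ && _); rewrite andbC andb_idr // => /eqP defB'.
    by rewrite -defB -defB' -setIA upperS.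
  rewrite -exprD; congr (_ ^+ _).
  have sBB' : B \subset B' by rewrite -defB subsetIl.
  have sB'I : B' \subset I by rewrite -defB2 subsetIl.
  have := cardsDS sBB'; have := cardsDS sB'I; have := cardsDS (subset_trans sBB' sB'I).
  by have := subset_leq_card sBB'; have := subset_leq_card sB'I; lia.
move=> I /andP[clI /eqP <-]; rewrite -setIA upperS eqxx andbT.
have := clI => /down_closedP[sI dI]; apply/down_closedP; split=> [p|p p' Up].
  by rewrite inE => /andP[].
by rewrite !(in_setI, Up) andbT => /andP[Ip' _]; apply: dI; rewrite ?inE.
Qed.

(** Adding a row is one application of [alternant_interlace]. In the normalizing product, the powers
    of ['X] undo the slant and the factors ['X ^+ j.+1 - 1] come from the interlacing sums. *)
Let extensions_alternant t B : (t <= N.+1)%N -> down_closed e (upper t) B ->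
  extensions t B * \prod_(s < t.+1) ('X ^+ (\sum_(i < s) 2 * i) *
                                     \prod_(j < s) ('X ^+ j.+1 - 1)) =
  alternant 'X (fun i : 'I_t.+1 => slanted B t i).
Proof.
elim: t B => [|t IHt] B ht clB.
  rewrite big_ord_recl !big_ord0 expr0 !mulr1 /extensions.
  rewrite (big_pred1 B) => [|I] /=; last first.
    apply/andP/eqP=> [[_ /eqP <-]|->]; first by apply/setP=> p; rewrite !inE andbT.
    by split=> //; apply/eqP/setP=> p; rewrite !inE andbT.
  by rewrite setDv cards0 expr0 /alternant det_mx11 mxE muln0 expr0.
rewrite ltnS in ht; rewrite (@alternant_interlace _ _ _ K (slanted B t.+1)); last first.
  by move=> i hi; apply: slanted_mono => //; rewrite -ltnS hi.
rewrite extensionsS // sum_extensions // big_ord_recr /= mulrA [X in _ * X]mulrC.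
rewrite mulrA mulrAC; congr (_ * _); rewrite !big_distrl /=; apply: eq_bigr => m hm.
have -> : (B :|: row m) :\: B = row m.
  by rewrite setDUl setDv set0U; apply/setDidPl; rewrite disjoint_sym disjoint_row.
rewrite -(card_row ht clB hm) exprD.
have clB' := down_closed_row ht clB hm.
have -> : alternant 'X (fun i => m i) = alternant 'X (fun i : 'I_t.+1 => slanted (B :|: row m) t i) :> {poly int}.
  congr (\det _); apply/matrixP=> i j; rewrite !mxE; congr (_ ^+ (_ * _)).
  have hi : (i <= t)%N by rewrite -ltnS.
  rewrite /slanted (height_row ht clB hm hi) subnK ?bound_val //.
  by have := mem_interlacing hm hi; rewrite bound_val; lia.
by rewrite -IHt 1?ltnW //; ring.
Qed.

(** At [t = N.+1] nothing is prescribed and the slanted heights are [2 * i]; after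
    [alternant_double] the nonzero normalizing product cancels. *)
Lemma genfun_zigzag :
  genfun e setT = \prod_(t < N.+2) \prod_(j < t) (1 + 'X ^+ j.+1).
Proof.
have upper_top : upper N.+1 = set0.
  by apply/setP=> p; rewrite !inE; have := coord_sum p; lia.
have upper_bot : upper 0 = setT by apply/setP=> p; rewrite !inE.
have cl0 : down_closed e (upper N.+1) set0.
  by apply/down_closedP; split=> [p|p p' _]; rewrite inE.
have := extensions_alternant (leqnn _) cl0.
have -> : extensions N.+1 set0 = genfun e setT.
  rewrite /extensions upper_top upper_bot; apply: eq_big => [I|I _].
    by rewrite setI0 eqxx andbT.
  by rewrite setD0.
have -> : alternant 'X (fun i : 'I_N.+2 => slanted set0 N.+1 i) =
    alternant 'X (fun i : 'I_N.+2 => 2 * i)%N :> {poly int}.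
  congr (\det _); apply/matrixP=> i j; rewrite !mxE /slanted /height.
  rewrite (_ : [set p in set0 | _] = set0) ?cards0 //.
  by apply/setP=> p; rewrite !inE.
rewrite alternant_double [RHS]mulrC; apply: mulIf.
apply/prodf_neq0=> s _; rewrite mulf_neq0 ?expf_neq0 ?polyX_eq0 //.
by apply/prodf_neq0=> j _; rewrite -size_poly_eq0 size_XnsubC.
Qed.

End Zigzag.

(** * The tetrahedral posets *)

(** Closure under single steps propagates along the paths that define the order. *)
Lemma order_idealsE n (S : {set color}) (I : {set tetra n S}) :
  (I \in order_ideals (tetra n S)) = down_closed (@tetra_step n S) setT I.
Proof.
rewrite inE; apply/idP/down_closedP=> [idI|[_ clI]].
  split=> [p|p p' _ Ip' epp']; first by rewrite inE.
  move/forall_inP: idI => /(_ p' Ip')/forallP/(_ p)/implyP; apply.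
  exact: connect1.
apply/forall_inP=> p Ip; apply/forallP=> p'; apply/implyP=> /connectP[s].
elim: s p' => [|q s IHs] p' /=; first by move=> _ <-.
by case/andP=> epq /IHs{}IHs /IHs Iq; apply: clI epq; rewrite ?inE.
Qed.

Lemma ideal_genfunE n (S : {set color}) :
  ideal_genfun (tetra n S) = @genfun (tetra n S) (@tetra_step n S) setT.
Proof. by apply: eq_bigl => I; rewrite order_idealsE. Qed.

Section Coordinates.
Variable n : nat.
Implicit Types p : tetra_point n.

Definition coord1 p : nat := (val p).1.1.
Definition coord2 p : nat := (val p).1.2.
Definition coord3 p : nat := (val p).2.
Definition coord0 p : nat := (n - 2 - coord1 p - coord2 p - coord3 p)%N.

Lemma coordP : (2 <= n)%N -> barycentric (n - 2) coord0 coord1 coord3 coord2.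
Proof.
move=> n2; rewrite /coord0 /coord1 /coord2 /coord3; split.
- by case=> [[[a b] c] /= h]; lia.
- case=> [[[a b] c] /= h] [[[a' b'] c'] /= h'] _ eqa eqc eqb.
  by apply: val_inj; rewrite /=; congr (_, _, _); apply: val_inj.
- move=> i j k l hs.
  have hj : (j < n.-1)%N by lia.
  have hl : (l < n.-1)%N by lia.
  have hk : (k < n.-1)%N by lia.
  have h : (j + l + k <= n - 2)%N by lia.
  exists (exist (fun c : 'I_n.-1 * 'I_n.-1 * 'I_n.-1 => c.1.1 + c.1.2 + c.2 <= n - 2)%N
            (Ordinal hj, Ordinal hl, Ordinal hk) h).
  by split=> //=; lia.
Qed.

Lemma tetra_stepE S p p' : tetra_step S p p' =
  [|| (Red \in S) && transfer coord0 coord1 coord3 coord2 p p',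
      (Green \in S) && transfer coord0 coord2 coord1 coord3 p p',
      (Yellow \in S) && transfer coord0 coord3 coord1 coord2 p p',
      (Blue \in S) && transfer coord1 coord2 coord0 coord3 p p',
      (Orange \in S) && transfer coord1 coord3 coord0 coord2 p p'
    | (Silver \in S) && transfer coord3 coord2 coord0 coord1 p p'].
Proof.
rewrite /tetra_step /coords -/(coord1 p) -/(coord2 p) -/(coord3 p).
rewrite -/(coord1 p') -/(coord2 p') -/(coord3 p').
have eqE (t t' : int * int * int) :
    (t == t') = [&& t.1.1 == t'.1.1, t.1.2 == t'.1.2 & t.2 == t'.2].
  by case: t t' => [[? ?] ?] [[? ?] ?]; rewrite -!pair_eqE /= andbA.
have: (coord0 p + coord1 p + coord2 p + coord3 p = n - 2)%N.
  by rewrite /coord0 /coord1 /coord2 /coord3; case: p => [[[a b] c] /= h]; lia.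
have: (coord0 p' + coord1 p' + coord2 p' + coord3 p' = n - 2)%N.
  by rewrite /coord0 /coord1 /coord2 /coord3; case: p' => [[[a b] c] /= h]; lia.
rewrite /transfer; move: (coord0 p) (coord1 p) (coord2 p) (coord3 p) => a b c d.
move: (coord0 p') (coord1 p') (coord2 p') (coord3 p') => a' b' c' d' sum' sum.
apply/exists_inP/idP=> [[x Sx]|].
  rewrite eqE; case: x Sx => /= -> step; rewrite /=.
  - by apply/orP; left; lia.
  - by do 1!(apply/orP; right); apply/orP; left; lia.
  - by do 2!(apply/orP; right); apply/orP; left; lia.
  - by do 3!(apply/orP; right); apply/orP; left; lia.
  - by do 4!(apply/orP; right); apply/orP; left; lia.
  - by do 5!(apply/orP; right); lia.
by do 5?[case/orP]; case/andP=> Sx hx;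
  [exists Red|exists Green|exists Yellow|exists Blue|exists Orange|exists Silver];
  rewrite // eqE /=; lia.
Qed.

End Coordinates.

Lemma card_colors (S : {set color}) :
  #|S| = ((Red \in S) + (Green \in S) + (Yellow \in S) +
          (Blue \in S) + (Orange \in S) + (Silver \in S))%N.
Proof.
rewrite -sum1_card big_mkcond /= (reindex ord_to_color) /=; last first.
  exists color_to_ord => [i _|c _]; last exact: color_to_ordK.
  by apply/val_inj; case: i => -[|[|[|[|[|[|]]]]]].
rewrite !big_ord_recl big_ord0 /=.
by do 6!case: (_ \in S).
Qed.

Lemma genfun_tetra n (S : {set color}) :
    (2 <= n)%N -> admissible S -> #|S| = 3%N ->
    S \notin [set [set Red; Green; Yellow]; [set Silver; Blue; Green]] ->
  @genfun (tetra n S) (@tetra_step n S) setT =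
  \prod_(t < n) \prod_(j < t) (1 + 'X ^+ j.+1).
Proof.
move=> n2 admS cardS excS.
suff: @genfun (tetra n S) (@tetra_step n S) setT =
    \prod_(t < (n - 2).+2) \prod_(j < t) (1 + 'X ^+ j.+1).
  by rewrite (_ : (n - 2).+2 = n)%N //; lia.
have excl R : R \in [set [set Red; Green; Yellow]; [set Silver; Blue; Green]] ->
    ~ (forall c, (c \in S) = (c \in R)).
  by move=> RR eqSR; move: excS; rewrite (_ : S = R) ?RR //; apply/setP.
have excl1 := excl [set Red; Green; Yellow] _.
have excl2 := excl [set Silver; Blue; Green] _.
move: admS cardS excl1 excl2; rewrite /admissible !subUset !sub1set card_colors.
have stepE := @tetra_stepE n S; have coords := coordP n2.
(* The order of coordinates here is [coord0], [coord1], [coord2], [coord3]. *)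
have coords' := barycentric_rot (barycentric_rot (barycentric_swap
  (barycentric_rot (barycentric_rot coords)))).
(* Eleven sets are admissible of size three, two of them excluded. The other nine are four chains,
   one for each coordinate left fixed, and five zigzags. *)
case hR: (Red \in S) stepE; case hG: (Green \in S); case hY: (Yellow \in S);
case hB: (Blue \in S); case hO: (Orange \in S); case hS: (Silver \in S) => //= stepE _ _;
try (by move=> /(_ (set21 _ _))[]; case; rewrite !inE);
try (by move=> _ /(_ (set22 _ _))[]; case; rewrite !inE); move=> _ _.
- apply: (genfun_chain coords') => p p'.
  by rewrite stepE /transfer; lia.
- apply: (genfun_zigzag (barycentric_swap (barycentric_rot (barycentric_swap coords)))) => p p'.
  by rewrite stepE /transfer; lia.
- apply: (genfun_chain coords) => p p'.
  by rewrite stepE /transfer; lia.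
- apply: (genfun_zigzag (barycentric_swap coords')) => p p'.
  by rewrite stepE /transfer; lia.
- apply: (genfun_zigzag (barycentric_swap coords)) => p p'.
  by rewrite stepE /transfer; lia.
- apply: (genfun_chain (barycentric_rot (barycentric_swap coords))) => p p'.
  by rewrite stepE /transfer; lia.
- apply: (genfun_zigzag coords') => p p'.
  by rewrite stepE /transfer; lia.
- apply: (genfun_zigzag coords) => p p'.
  by rewrite stepE /transfer; lia.
- apply: (genfun_chain (barycentric_rot coords)) => p p'.
  by rewrite stepE /transfer; lia.
Qed.

(** * Product formulas *)

(** The factor [F j] occurs once for each [t] with [j <= t < n]. *)
Lemma prod_staircase (R : comNzRingType) (F : nat -> R) n :
  \prod_(t < n) \prod_(j < t) F j.+1 = \prod_(1 <= j < n) F j ^+ (n - j).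
Proof.
elim: n => [|n IHn]; first by rewrite big_ord0 big_geq.
rewrite big_ord_recr /= IHn; case: n {IHn} => [|n].
  by rewrite !big_geq // big_ord0 mulr1.
rewrite [RHS]big_nat_recr //= subSnn expr1 big_ord_recr /= mulrA; congr (_ * _).
have -> : \prod_(j < n) F j.+1 = \prod_(1 <= j < n.+1) F j.
  by rewrite big_add1 big_mkord.
rewrite -big_split /=; apply: eq_big_nat => j /andP[_ lt_jn].
by rewrite -exprSr (subSn (ltnW lt_jn)).
Qed.

Lemma qint_double j : qint (j + j) = (1 + 'X^j) * qint j.
Proof.
rewrite /qint big_split_ord /= mulrDl mul1r; congr (_ + _).
by rewrite big_distrr; apply: eq_bigr => i _; rewrite exprD.
Qed.

Lemma qint_neq0 m : (0 < m)%N -> qint m != 0.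
Proof.
move=> m0; apply/eqP=> /(congr1 (horner^~ 1)); rewrite horner0 /qint horner_sum.
under eq_bigr => i _ do rewrite hornerXn expr1n.
by rewrite sumr_const card_ord => /eqP; rewrite pnatr_eq0; lia.
Qed.

(** The fraction does not involve [k], so the innermost product is a power with exponent [n - j].
    The product over [i <= j] then telescopes to the ratio of [qint (j + j)] to [qint j], which is
    [1 + 'X^j]. *)
Lemma prod_qint_ratio n :
  (\prod_(1 <= j < n) (1 + 'X^j) ^+ (n - j)%N : {poly int})%:F =
    \prod_(1 <= i < n) \prod_(i <= j < n) \prod_(j <= k < n)
      ((qint (i + j))%:F / (qint (i + j - 1))%:F) :> {fraction {poly int}}.
Proof.
pose f i j := (qint (i + j))%:F / (qint (i + j - 1))%:F.
transitivity (\prod_(1 <= j < n) \prod_(1 <= i < n | (i <= j)%N) f i j ^+ (n - j)).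
  rewrite rmorph_prod; apply: eq_big_nat => j /andP[j1 ltjn].
  rewrite rmorphXn prodrXl; congr (_ ^+ _).
  have -> : \prod_(1 <= i < n | (i <= j)%N) f i j = \prod_(1 <= i < j.+1) f i j.
    by rewrite [RHS](big_nat_widen _ _ n).
  rewrite (telescope_prodf_eq (fun i => (qint (i + j - 1))%:F)) //; first last.
  - by move=> i _; rewrite addSn subn1.
  - by move=> i /andP[i1 _]; rewrite tofrac_eq0 qint_neq0 //; lia.
  rewrite addSn addKn subn1 /= qint_double rmorphM mulfK //.
  by rewrite tofrac_eq0 qint_neq0.
rewrite [RHS](eq_big_nat _ _ (F2 := fun i => \prod_(1 <= j < n | (i <= j)%N) f i j ^+ (n - j))); last first.
  move=> i /andP[i1 _]; rewrite (big_nat_widenl _ 1%N) //.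
  by apply: eq_bigr => j _; rewrite prodr_const_nat.
by rewrite [RHS](exchange_big_dep_nat xpredT).
Qed.

Theorem theorem10 (n : nat) (S : {set color})
    (hn : (2 <= n)%N) (hadm : admissible S) (hcard : #|S| = 3%N)
    (hS : S \notin [set [set Red; Green; Yellow]; [set Silver; Blue; Green]]) :
  [/\ ideal_genfun (tetra n S) = \prod_(1 <= j < n) (1 + 'X^j) ^+ (n - j)%N,
      (\prod_(1 <= j < n) (1 + 'X^j) ^+ (n - j)%N : {poly int})%:F =
        \prod_(1 <= i < n) \prod_(i <= j < n) \prod_(j <= k < n)
          ((qint (i + j))%:F / (qint (i + j - 1))%:F) :> {fraction {poly int}}
    & #|order_ideals (tetra n S)| = (2 ^ 'C(n, 2))%N].
Proof.
have gfE := ideal_genfunE n S; rewrite genfun_tetra // in gfE.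
split; first by rewrite gfE (prod_staircase (fun j => 1 + 'X^j)).
  exact: prod_qint_ratio.
(* At [q = 1] every factor is 2, and there are [t] of them for each [t < n]. *)
move/(congr1 (horner^~ 1)): gfE; rewrite /ideal_genfun horner_sum.
under eq_bigr => I _ do rewrite hornerXn expr1n.
rewrite sumr_const horner_prod => card_ideals.
have: #|order_ideals (tetra n S)|%:R = (2 ^ 'C(n, 2))%:R :> int.
  rewrite card_ideals -bin2_sum big_mkord natrX -prodrXr; apply: eq_bigr => t _.
  rewrite horner_prod (eq_bigr (fun=> 2)) ?prodr_const ?card_ord // => j _.
  by rewrite !hornerE expr1n.
by move/eqP; rewrite eqr_nat => /eqP.
Qed.
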